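(* Let $\mathcal{C}^n=(M^n,K(x,p))$, $n\ge 4$, be an $m$-th root Cartan space, $m\ge 3$, with metric $K(x,p)=\sqrt[m]{a^{i_1i_2\ldots i_m}(x)p_{i_1}p_{i_2}\cdots p_{i_m}}$, and suppose that the matrix $(a^{ij})$ is invertible. Then the $v$-curvature d-tensor $S^{hijk}=C_r^{ij}C^{rhk}-C_r^{ik}C^{rhj}$ can be written on $T^*M\setminus\{0\}$ in the form $$S^{hijk}=\frac{(m-1)(m-2)^2}{4K^2}\,\mathcal{A}_{\{j,k\}}\left\{a_r^{ij}a^{rhk}-a^{ij}\left(a^{hk}-a^ha^k\right)+a^ia^ja^{hk}\right\},$$ where $\mathcal{A}_{\{j,k\}}$ denotes the alternate sum in $j,k$, i.e. $\mathcal{A}_{\{j,k\}}\{F^{jk}\}=F^{jk}-F^{kj}$.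
   Context: The summation convention is used; indices (including the index $h$) run over $1,\dots,n$; $(x^i,p_i)$ are the induced local coordinates on the cotangent bundle $T^*M$ of an $n$-dimensional smooth manifold $M$; $\dot\partial^i=\partial/\partial p_i$. A Cartan space $(M^n,K(x,p))$ is a manifold $M$ with a real function $K$ on $T^*M$ which is positive and differentiable (smooth) on $T^*M\setminus\{0\}$, continuous on the null section, positively $1$-homogeneous in the momenta $p_i$, and such that the matrix $g^{ij}(x,p)=\frac12\dot\partial^i\dot\partial^jK^2$ is positive definite on $T^*M\setminus\{0\}$. It is an $m$-th root Cartan space if $K(x,p)=\sqrt[m]{a^{i_1\ldots i_m}(x)p_{i_1}\cdots p_{i_m}}$, where $a^{i_1\ldots i_m}(x)$ depends on the position only and is symmetric in all its indices. Notation: $a^i=\left[a^{ii_2\ldots i_m}(x)p_{i_2}\cdots p_{i_m}\right]/K^{m-1}$, $a^{ij}=\left[a^{iji_3\ldots i_m}(x)p_{i_3}\cdots p_{i_m}\right]/K^{m-2}$, $a^{ijk}=\left[a^{ijki_4\ldots i_m}(x)p_{i_4}\cdots p_{i_m}\right]/K^{m-3}$. The matrix $(a_{ij})$ is the inverse of $(a^{ij})$, and $a_i^{jk}=a_{is}a^{sjk}$. The matrix $(g_{ij})$ is the inverse of $(g^{ij})$. The $v$-torsion d-tensor is $C^{ijk}=-\frac12\dot\partial^kg^{ij}$, and $C_i^{jk}=g_{is}C^{sjk}$. *)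

(* Defs.v *)
From HB Require Import structures.
From mathcomp Require Import all_boot all_order all_algebra.
From mathcomp Require Import all_classical all_reals all_analysis.

Set Implicit Arguments.
Unset Strict Implicit.
Unset Printing Implicit Defensive.

Import Order.TTheory GRing.Theory Num.Theory.
Import numFieldNormedType.Exports.
Local Open Scope classical_set_scope.
Local Open Scope ring_scope.

(** C^k and C^infinity maps on an open set [A]: Frechet differentiable at every
    point of [A], with all directional derivatives of class C^(k-1).  Only the
    germs of [f] at the points of [A] matter. *)
Fixpoint Ck (R : realType) (V W : normedModType R) (k : nat) (A : set V)
    (f : V -> W) : Prop :=
  if k is k'.+1 then
    (forall x, A x -> differentiable f x) /\
    (forall v : V, Ck k' A (fun x => 'D_v f x : W))
  else forall x, A x -> {for x, continuous f}.

Definition smooth_on (R : realType) (V W : normedModType R) (A : set V)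
    (f : V -> W) : Prop := forall k, Ck k A f.

(** [chart_map] and [chart_inv] are total functions whose values are only
    meaningful on [chart_dom] and on [chart_img] respectively. *)
Record chart (R : realType) (n : nat) (M : topologicalType) := Chart {
  chart_dom : set M ;
  chart_map :> M -> 'rV[R]_n ;
  chart_inv : 'rV[R]_n -> M ;
  chart_dom_open : open chart_dom ;
  chart_img_open : open (chart_map @` chart_dom) ;
  chart_mapK : forall x, chart_dom x -> chart_inv (chart_map x) = x ;
  chart_map_cts : forall x, chart_dom x -> {for x, continuous chart_map} ;
  chart_inv_cts : forall u, (chart_map @` chart_dom) u ->
    {for u, continuous chart_inv} }.

Definition chart_img (R : realType) (n : nat) (M : topologicalType)
    (c : chart R n M) : set 'rV[R]_n := c @` chart_dom c.

(** The atlas is not required to be maximal; it may be. *)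
Record manifold (R : realType) (n : nat) := Manifold {
  carrier :> topologicalType ;
  atlas : set (chart R n carrier) ;
  manifold_hausdorff : hausdorff_space carrier ;
  manifold_second_countable : @second_countable carrier ;
  atlas_cover : forall x : carrier, exists2 c, atlas c & chart_dom c x ;
  atlas_smooth : forall c d, atlas c -> atlas d ->
    smooth_on (c @` (chart_dom c `&` chart_dom d)) (d \o chart_inv c) }.

Definition chart_at (R : realType) (n : nat) (M : manifold R n) (x : M)
    (c : chart R n M) : Prop := atlas c /\ chart_dom c x.

(** ['J f u] acts on row vectors from the right, so that its (j, i) entry is
    the derivative of the i-th component of [f] in the j-th direction.  With
    [x] the coordinates in [c] and [x'] those in [d], the (j, i) entry of
    [jac c d y] is therefore dx^i/dx'^j at [y]. *)
Definition jac (R : realType) (n : nat) (M : manifold R n)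
    (c d : chart R n M) (y : M) : 'M[R]_n := 'J (c \o chart_inv d) (d y).

(** The points of T*M: a base point together with the momenta p_i in every chart
    at this point, subject to the transformation law p'_j = (dx^i/dx'^j) p_i.
    The components in the other charts are set to 0 so that each covector has a
    unique representation. *)
Record cotangent (R : realType) (n : nat) (M : manifold R n) := Cotangent {
  base : M ;
  momenta : chart R n M -> 'rV[R]_n ;
  momentaE : forall c d, chart_at base c -> chart_at base d ->
    momenta d = momenta c *m (jac c d base)^T ;
  momenta_out : forall c, ~ chart_at base c -> momenta c = 0 }.

Section Covector.
Context (R : realType) (n : nat) (M : manifold R n).
Implicit Types (c d e : chart R n M) (y : M).

Lemma atlas_differentiable c d y : chart_at y c -> chart_at y d ->
  differentiable (c \o chart_inv d) (d y).
Proof.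
move=> [ac cy] [ad dy]; have [+ _] := atlas_smooth ad ac 1%N; apply.
by exists y.
Qed.

Lemma mul_jac c d y (v : 'rV[R]_n) : chart_at y c -> chart_at y d ->
  v *m jac c d y = 'D_v (c \o chart_inv d) (d y).
Proof.
by move=> hc hd; symmetry; apply: deriveEjacobian; exact: atlas_differentiable.
Qed.

Lemma jac_comp c d e y : chart_at y c -> chart_at y d -> chart_at y e ->
  jac c e y = jac d e y *m jac c d y.
Proof.
move=> hc hd he; have dyK := chart_mapK he.2.
have dde := atlas_differentiable hd he.
have dyE : (d \o chart_inv e) (e y) = d y by rewrite /= dyK.
have dcd : differentiable (c \o chart_inv d) ((d \o chart_inv e) (e y)).
  by rewrite dyE; exact: atlas_differentiable.
apply/row_matrixP => i; rewrite !rowE mulmxA; set v := delta_mx _ _.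
apply: (etrans (mul_jac v hc he)).
apply: esym; apply: (etrans (mul_jac _ hc hd)); apply: esym.
rewrite (mul_jac v hd he).
have -> : 'D_v (c \o chart_inv e) (e y) =
    'D_v ((c \o chart_inv d) \o (d \o chart_inv e)) (e y).
  apply: near_eq_derive.
  have ecy : (e @` chart_dom e) (e y) by exists y => //; exact: he.2.
  have nd : nbhs (chart_inv e (e y)) (chart_dom d).
    rewrite dyK; apply: open_nbhs_nbhs; split; last exact: hd.2.
    exact: chart_dom_open.
  have {}nd : nbhs (e y) (chart_inv e @^-1` chart_dom d).
    exact: (chart_inv_cts ecy nd).
  by apply: filterS nd => u /= du; rewrite chart_mapK.
have dcde := differentiable_comp dde dcd.
rewrite (deriveE v dcde) (diff_comp dde dcd) (deriveE v dde) -dyE.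
by rewrite (deriveE _ dcd).
Qed.

Definition covector_momenta c y (p : 'rV[R]_n) d : 'rV[R]_n :=
  if `[< chart_at y c /\ chart_at y d >] then p *m (jac c d y)^T else 0.

Lemma covector_momentaE c y p d e : chart_at y d -> chart_at y e ->
  covector_momenta c y p e = covector_momenta c y p d *m (jac d e y)^T.
Proof.
move=> hd he; rewrite /covector_momenta.
case: asboolP => [[hc _]|nc]; case: asboolP => [[hc' _]|nc'].
- by rewrite (jac_comp hc hd he) trmx_mul mulmxA.
- by case: nc'.
- by case: nc.
- by rewrite mul0mx.
Qed.

Lemma covector_momenta_out c y p d : ~ chart_at y d ->
  covector_momenta c y p d = 0.
Proof. by move=> nd; rewrite /covector_momenta; case: asboolP => [[]|]. Qed.

(** The point of T*M with induced coordinates (x^i, p_i) = ([u], [p]) in the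
    chart [c], for [u] in [chart_img c]. *)
Definition covector c (u p : 'rV[R]_n) : cotangent M :=
  Cotangent (@covector_momentaE c (chart_inv c u) p)
            (@covector_momenta_out c (chart_inv c u) p).

Lemma jac_id c y : chart_at y c -> jac c c y = 1%:M.
Proof.
move=> hc; apply/row_matrixP => i; rewrite !rowE mulmx1; set v := delta_mx _ _.
apply: (etrans (mul_jac v hc hc)).
have -> : 'D_v (c \o chart_inv c) (c y) = 'D_v id (c y).
  apply: near_eq_derive.
  have : nbhs (c y) (c @` chart_dom c).
    apply: open_nbhs_nbhs; split; first exact: chart_img_open.
    by exists y => //; exact: hc.2.
  by apply: filterS => _ [z dz <-] /=; rewrite chart_mapK.
exact: derive_id.
Qed.

Lemma covectorK c u p : atlas c -> chart_img c u ->
  [/\ chart_at (base (covector c u p)) c, c (base (covector c u p)) = u &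
      momenta (covector c u p) c = p].
Proof.
move=> ac [x dx <-]; have hc : chart_at (chart_inv c (c x)) c.
  by split=> //; rewrite chart_mapK.
split => //=; first by rewrite chart_mapK.
rewrite /covector_momenta; case: asboolP => [_|]; last by case.
by rewrite jac_id// trmx1 mulmx1.
Qed.

End Covector.

(** [local_expr K c u p] is K(x, p) in the coordinates induced by [c]. *)
Definition local_expr (R : realType) (n : nat) (M : manifold R n)
    (K : cotangent M -> R) (c : chart R n M) (u p : 'rV[R]_n) : R :=
  K (covector c u p).

Section Fibre.
(** [F] is the function p |-> K(x, p) for a fixed x. *)
Context (R : realType) (n : nat) (F : 'rV[R]_n -> R).
Implicit Types (p : 'rV[R]_n) (h i j k : 'I_n).

Definition pdot i (f : 'rV[R]_n -> R) (p : 'rV[R]_n) : R :=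
  'D_(delta_mx 0 i) f p.

Definition g_up p : 'M[R]_n :=
  \matrix_(i, j) (2^-1 * pdot i (pdot j (fun q => F q ^+ 2)) p).

Definition g_down p : 'M[R]_n := invmx (g_up p).

Definition C_up p i j k : R := - 2^-1 * pdot k (fun q => g_up q i j) p.

(** [C_mixed p i j k] is C_i^{jk}. *)
Definition C_mixed p i j k : R := \sum_s g_down p i s * C_up p s j k.

Definition S_up p h i j k : R :=
  \sum_r (C_mixed p r i j * C_up p r h k - C_mixed p r i k * C_up p r h j).

End Fibre.

Section RootCoefficients.
(** [A [:: i_1; ..; i_m]] is the coefficient a^{i_1...i_m} at a fixed x; only the
    values of [A] at sequences of length [m] matter. *)
Context (R : realType) (n m : nat) (A : seq 'I_n -> R) (F : 'rV[R]_n -> R).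
Implicit Types (p : 'rV[R]_n) (s : seq 'I_n) (i j k : 'I_n).

Definition symmetric_coef : Prop :=
  forall s t, size s = m -> perm_eq s t -> A s = A t.

(** With s = i_1 ... i_l: the sum of a^{i_1...i_l i_(l+1)...i_m} p_(i_(l+1))
    ... p_(i_m) over i_(l+1), ..., i_m. *)
Definition contraction p s : R :=
  \sum_(t : (m - size s).-tuple 'I_n) A (s ++ t) * \prod_(l <- t) p 0 l.

Definition a_up1 p i : R := contraction p [:: i] / F p ^+ (m - 1).

Definition a_up2 p : 'M[R]_n :=
  \matrix_(i, j) (contraction p [:: i; j] / F p ^+ (m - 2)).

Definition a_up3 p i j k : R := contraction p [:: i; j; k] / F p ^+ (m - 3).

Definition a_down2 p : 'M[R]_n := invmx (a_up2 p).

(** [a_mixed p i j k] is a_i^{jk}. *)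
Definition a_mixed p i j k : R := \sum_s a_down2 p i s * a_up3 p s j k.

End RootCoefficients.

Definition alternate (R : realType) (n : nat) (T : 'I_n -> 'I_n -> R)
    (j k : 'I_n) : R := T j k - T k j.

Record cartan_space (R : realType) (n : nat) (M : manifold R n)
    (K : cotangent M -> R) : Prop := CartanSpace {
  cartan_pos : forall c u (p : 'rV[R]_n), atlas c -> chart_img c u -> p != 0 ->
    0 < local_expr K c u p ;
  cartan_smooth : forall c, atlas c ->
    smooth_on [set z : 'rV[R]_n * 'rV[R]_n | chart_img c z.1 /\ z.2 != 0]
      (fun z => local_expr K c z.1 z.2 : R^o) ;
  cartan_null_cts : forall c u, atlas c -> chart_img c u ->
    {for (u, 0 : 'rV[R]_n), continuous
      (fun z : 'rV[R]_n * 'rV[R]_n => local_expr K c z.1 z.2 : R^o)} ;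
  cartan_homogeneous : forall c u (p : 'rV[R]_n) (l : R),
    atlas c -> chart_img c u -> 0 < l ->
    local_expr K c u (l *: p) = l * local_expr K c u p ;
  cartan_posdef : forall c u (p v : 'rV[R]_n),
    atlas c -> chart_img c u -> p != 0 -> v != 0 ->
    0 < (v *m g_up (local_expr K c u) p *m v^T) 0 0 }.

(** The coefficients a^{i_1...i_m}(x) are given by their components
    [a c u] at the point with coordinates [u] in each chart [c].  As K is
    real-valued and positive off the null section, the radicand cannot be
    negative; this is made explicit because [powR] takes an unrelated conventional
    value at negative numbers. *)
Definition mth_root_metric (R : realType) (n m : nat) (M : manifold R n)
    (K : cotangent M -> R)
    (a : chart R n M -> 'rV[R]_n -> seq 'I_n -> R) : Prop :=
  forall c u, atlas c -> chart_img c u ->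
    symmetric_coef m (a c u) /\
    forall p, 0 <= contraction m (a c u) p [::] /\
      local_expr K c u p = contraction m (a c u) p [::] `^ (m%:R^-1).

(* Main.v *)
(** Write [a] for the contractions of the coefficients normalised by powers of
    [F] (indices up).  Since [F ^+ m] is a form of degree [m], the chain
      d^k a^{i_1..i_l} = (m - l) / F * (a^{i_1..i_l k} - a^{i_1..i_l} a^k)
    yields [g = (m - 1) a - (m - 2) a1 a1^T] and
    [C = - (m - 1) (m - 2) / (2 F) * T], where [T] is [vtorsion] below.  Euler's
    identities for [l_i = p_i / F] say that contracting one index of
    [a^{i_1..i_l}] with [l] removes it.  Hence [g^-1] is the rank-one update
    [(a^-1 + (m - 2) l l^T) / (m - 1)]; as [l] annihilates [T], the inverse
    [g^-1] may be replaced by [a^-1 / (m - 1)] in [S].  After expansion, the terms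
    absent from the formula cancel in the alternate sum over [j, k]. *)
Require Import Defs.
From mathcomp Require Import all_boot all_order all_algebra.
From mathcomp Require Import all_classical all_reals all_analysis.
From mathcomp Require Import ring.

Import Order.TTheory GRing.Theory Num.Theory.
Import numFieldNormedType.Exports.
Local Open Scope classical_set_scope.
Local Open Scope ring_scope.

Set Implicit Arguments.
Unset Strict Implicit.
Unset Printing Implicit Defensive.

(* [all_analysis] exports another constant named [contraction]. *)
Local Notation contraction := Defs.contraction.

(** * Contractions of the coefficients and their derivatives in the momenta *)

Lemma big_tuple_cons (R : nmodType) (T : finType) (k : nat) (G : seq T -> R) :
  \sum_(t : k.+1.-tuple T) G t = \sum_i \sum_(t : k.-tuple T) G (i :: t).
Proof.
rewrite pair_big /= (reindex (fun z : T * k.-tuple T => [tuple of z.1 :: z.2])).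
  exact: eq_bigr.
exists (fun t => (thead t, [tuple of behead t])) => [[i t]|t] _ /=.
  by congr (_, _); apply: val_inj.
by rewrite -tuple_eta.
Qed.

Section Contraction.
Context (R : realType) (n m : nat) (A : seq 'I_n -> R).
Implicit Types (p : 'rV[R]_n) (s t : seq 'I_n).

Lemma contraction_rcons p s : (size s < m)%N ->
  contraction m A p s = \sum_i p 0 i * contraction m A p (rcons s i).
Proof.
move=> sm; rewrite /contraction -(subnSK sm).
rewrite (big_tuple_cons _ (fun t => A (s ++ t) * \prod_(l <- t) p 0 l)).
apply: eq_bigr => i _; rewrite size_rcons mulr_sumr; apply: eq_bigr => t _.
by rewrite big_cons cat_rcons mulrCA.
Qed.

Lemma contraction_perm p s t : symmetric_coef m A -> (size s <= m)%N ->
  perm_eq s t -> contraction m A p s = contraction m A p t.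
Proof.
move=> symA sm st; rewrite /contraction (perm_size st); apply: eq_bigr => r _.
congr (_ * _); apply: symA; last by rewrite perm_cat2r.
by rewrite size_cat size_tuple (perm_size st) subnKC // -(perm_size st).
Qed.

Lemma is_derive_coord p v (i : 'I_n) :
  is_derive p v (fun q : 'rV[R]_n => q 0 i) (v 0 i).
Proof.
have did : derivable (id : 'rV[R]_n -> _) p v by exact: derivable_id.
apply: DeriveDef; first by have /derivable_mxP := did; exact.
by have := derive_mx did; rewrite derive_id => /matrixP/(_ 0 i); rewrite mxE.
Qed.

(** Induction on the number of contracted slots. [contraction_rcons] exposes a factor p_i:
    differentiating it yields one copy of the result, and the induction hypothesis yields the [k]
    others. *)
Lemma is_derive_contraction p s (j : 'I_n) : symmetric_coef m A ->
  (size s <= m)%N ->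
  is_derive p (delta_mx 0 j) (fun q => contraction m A q s)
    ((m - size s)%:R * contraction m A p (rcons s j)).
Proof.
move=> symA; move Dk : (m - size s)%N => k.
elim: k s Dk => [|k IH] s Dk sm.
  (* All slots are filled, so the contraction is constant in p; the factor 0 absorbs the value at
     [rcons s j], a list longer than [m]. *)
  rewrite mul0r (_ : (fun q => _) = cst (A s)); first exact: is_derive_cst.
  apply/funext => q; rewrite /contraction Dk (big_pred1 [tuple]) => [|t].
    by rewrite cats0 big_nil mulr1.
  by rewrite [t]tuple0 /= eqxx.
have sm' : (size s < m)%N by rewrite -subn_gt0 Dk.
have Dk' i : (m - size (rcons s i))%N = k by rewrite size_rcons subnS Dk.
have sm2 i : (size (rcons s i) <= m)%N by rewrite size_rcons.
rewrite (_ : (fun q => _) = \sum_(i < n) (fun q : 'rV[R]_n => q 0 i) *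
    (fun q => contraction m A q (rcons s i))); last first.
  by apply/funext => q; rewrite contraction_rcons // fct_sumE.
have dM i := is_deriveM (is_derive_coord p (delta_mx 0 j) i)
   (IH _ (Dk' i) (sm2 i)).
apply: (is_derive_eq (is_derive_sum dM)).
rewrite (eq_bigr (fun i => (i == j)%:R * contraction m A p (rcons s i) +
    k%:R * (p 0 i * contraction m A p (rcons (rcons s j) i)))) => [|i _].
  rewrite big_split /= -mulr_sumr -natr1 mulrDl mul1r addrC; congr (_ + _).
    (* If [k = 0], then [rcons s j] already has length [m] and no further index can be split off;
       both sides vanish because of the factor [k]. *)
    case: k {IH} Dk Dk' dM => [|k] _ Dk' _; first by rewrite !mul0r.
    by rewrite -contraction_rcons // -subn_gt0 Dk'.
  under eq_bigr do rewrite mulr_natl mulrb.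
  by rewrite -big_mkcond big_pred1_eq.
rewrite /GRing.scale /= mxE eqxx /= mulrCA [X in _ + X]mulrC [LHS]addrC.
congr (_ + _).
case: k {IH} Dk Dk' dM => [|k] _ Dk' _; first by rewrite !mul0r.
congr (_ * (_ * _)); apply: contraction_perm => //.
  by rewrite size_rcons -subn_gt0 Dk'.
by rewrite -!cats1 -!catA perm_cat2l (perm_catC [:: i]).
Qed.
End Contraction.

(** * Linear and tensor algebra behind the curvature identity *)

Lemma invmx_rank_one_update (R : fieldType) (n : nat) (N : 'M[R]_n)
    (x l : 'cV[R]_n) (c : R) : c != 0 -> N \in unitmx -> N^T = N ->
  N *m l = x -> l^T *m x = 1%:M ->
  invmx (c *: N - (c - 1) *: (x *m x^T)) =
  c^-1 *: (invmx N + (c - 1) *: (l *m l^T)).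
Proof.
move=> c0 uN symN Nl lx.
have lN : l^T *m N = x^T by rewrite -Nl trmx_mul symN.
have Nx : invmx N *m x = l by rewrite -Nl mulKmx.
set G := (_ - _); set B := (RHS).
(* For square matrices a left inverse suffices; it also shows that [G] is invertible. *)
suff BG : B *m G = 1%:M.
  by have [_ uG] := mulmx1_unit BG; rewrite -[B](mulmxK uG) BG mul1mx.
rewrite /B /G mulmxBr -!scalemxAl -!scalemxAr !mulmxDl mulVmx // mulmxA Nx.
rewrite -!scalemxAl -!mulmxA lN (mulmxA l^T x) lx mul1mx.
(* Besides the identity there remain multiples of l x^T, with total coefficient c^-1 (c - 1) (-1 + c
   - (c - 1)) = 0. *)
apply/matrixP => i j; rewrite !mxE; field; exact: c0.
Qed.

Section Curvature.
Context (R : fieldType) (n : nat).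
Variables (N : 'I_n -> 'I_n -> R) (l a1 : 'I_n -> R) (a2 : 'I_n -> 'I_n -> R).
Variable a3 : 'I_n -> 'I_n -> 'I_n -> R.
Hypothesis a2C : forall i j, a2 i j = a2 j i.
Hypothesis a3C12 : forall i j k, a3 i j k = a3 j i k.
Hypothesis a3C23 : forall i j k, a3 i j k = a3 i k j.
Hypothesis a1_l : \sum_r l r * a1 r = 1.
Hypothesis a2_l : forall i, \sum_r l r * a2 r i = a1 i.
Hypothesis a3_l : forall i j, \sum_r l r * a3 r i j = a2 i j.
Hypothesis N_sym : forall r s, N r s = N s r.
Hypothesis N_a1 : forall r, \sum_s N r s * a1 s = l r.
Hypothesis N_a2 : forall r i, \sum_s N r s * a2 s i = (r == i)%:R.

Let T i j k := a3 i j k - a2 i j * a1 k - a2 i k * a1 j - a2 j k * a1 i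
  + 2 * a1 i * a1 j * a1 k.

Let am r i j := \sum_s N r s * a3 s i j.

(** The weight [f] is arbitrary because three choices occur: [l], a row of [N], and [am] with its
    two upper indices fixed. *)
Let sum_T (f : 'I_n -> R) i j : \sum_r f r * T r i j =
  \sum_r f r * a3 r i j - (\sum_r f r * a2 r i) * a1 j
  - (\sum_r f r * a2 r j) * a1 i - a2 i j * (\sum_r f r * a1 r)
  + 2 * (\sum_r f r * a1 r) * a1 i * a1 j.
Proof.
rewrite -mulrA [2 * _]mulrC -!mulrA !mulr_suml mulr_sumr -!sumrB -big_split /=.
by apply: eq_bigr => r _; rewrite /T; ring.
Qed.

Let l_T i j : \sum_r l r * T r i j = 0.
Proof. by rewrite sum_T a3_l !a2_l a1_l; ring. Qed.

(** By symmetry [N] can be moved onto [a1], which turns it into [l]; Euler's identity [a3_l] then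
    applies. *)
Let am_a1 i j : \sum_r am r i j * a1 r = a2 i j.
Proof.
rewrite -a3_l; under eq_bigr do rewrite mulr_suml.
rewrite exchange_big; apply: eq_bigr => s _ /=; rewrite -N_a1 mulr_suml.
by apply: eq_bigr => r _; rewrite N_sym mulrAC.
Qed.

Let am_a2 i j h : \sum_r am r i j * a2 r h = a3 h i j.
Proof.
under eq_bigr do rewrite mulr_suml.
rewrite exchange_big /= (bigD1 h) //= [X in _ + X]big1 => [|s sh].
  rewrite addr0 (eq_bigr (fun r => a3 h i j * (N h r * a2 r h))).
    by rewrite -mulr_sumr N_a2 eqxx mulr1.
  by move=> r _; rewrite N_sym; ring.
rewrite (eq_bigr (fun r => a3 s i j * (N s r * a2 r h))).
  by rewrite -mulr_sumr N_a2 (negPf sh) mulr0.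
by move=> r _; rewrite N_sym; ring.
Qed.

Let N_T r i j : \sum_s N r s * T s i j = am r i j - (r == i)%:R * a1 j
  - (r == j)%:R * a1 i - a2 i j * l r + 2 * l r * a1 i * a1 j.
Proof. by rewrite sum_T N_a1 !N_a2. Qed.

Let sum_delta (f : 'I_n -> R) i : \sum_r (r == i)%:R * f r = f i.
Proof.
under eq_bigr do rewrite mulr_natl mulrb.
by rewrite -big_mkcond big_pred1_eq.
Qed.

Lemma curvature_rank_one_update c i j h k :
  let G r s := c^-1 * (N r s + (c - 1) * (l r * l s)) in
  let S j k := \sum_r (\sum_s G r s * T s i j) * T r h k in
  let B j k := \sum_r am r i j * a3 r h k - a2 i j * (a2 h k - a1 h * a1 k)
    + a1 i * a1 j * a2 h k in
  S j k - S k j = c^-1 * (B j k - B k j).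
Proof.
move=> G S B.
have GT r u v : \sum_s G r s * T s u v = c^-1 * \sum_s N r s * T s u v.
  transitivity (c^-1 * (\sum_s N r s * T s u v)
      + c^-1 * (c - 1) * l r * \sum_s l s * T s u v).
    rewrite !mulr_sumr -big_split; apply: eq_bigr => s _.
    by rewrite /G /=; ring.
  by rewrite l_T mulr0 addr0.
(* In the expansion [N_T], the two terms proportional to [l r] die against [T r h v]. The Kronecker
   terms are first written as sums over [r], so that both sides can be compared summand by
   summand. *)
have SE u v : S u v = c^-1 * (\sum_r am r i u * T r h v
    - a1 u * T i h v - a1 i * T u h v).
  rewrite -[T i h v](sum_delta (fun r => T r h v) i).
  rewrite -[T u h v](sum_delta (fun r => T r h v) u).
  transitivity (c^-1 * (\sum_r am r i u * T r h v
      - a1 u * (\sum_r (r == i)%:R * T r h v)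
      - a1 i * (\sum_r (r == u)%:R * T r h v)
      + (2 * a1 i * a1 u - a2 i u) * (\sum_r l r * T r h v))).
    rewrite [X in _ = c^-1 * X]addrC !mulr_sumr -!sumrB -big_split mulr_sumr.
    by apply: eq_bigr => r _ /=; rewrite GT N_T; ring.
  by rewrite l_T mulr0 addr0.
rewrite !SE -mulrBr; congr (_ * _); rewrite !sum_T !am_a1 !am_a2 /T /B.
(* Indices are brought to a common order, so that [ring] sees equal components as equal atoms and
   cancels the terms symmetric in [j] and [k]. *)
rewrite !(a3C12 h i) (a3C12 k i) (a3C12 j i) (a3C23 i k j) (a3C12 j h).
rewrite (a3C12 k h) (a3C23 h k j) (a2C j h) (a2C k h) (a2C k j).
ring.
Qed.

End Curvature.

(** * Calculus in a single fibre, for a function whose [m]-th power is a form *)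

Lemma near_neq0 (R : realType) (n : nat) (p : 'rV[R]_n) :
  p != 0 -> \forall q \near p, q != 0.
Proof.
move=> /eqP p0; have : nbhs p (~` [set 0]).
  apply: open_nbhs_nbhs; split=> //; apply: closed_openC.
  exact/accessible_closed_set1/hausdorff_accessible/norm_hausdorff.
by apply: filterS => q /eqP.
Qed.

Section RootMetric.
Context (R : realType) (n m : nat) (A : seq 'I_n -> R) (F : 'rV[R]_n -> R).
Hypothesis symA : symmetric_coef m A.
Hypothesis F_gt0 : forall q : 'rV[R]_n, q != 0 -> 0 < F q.
Hypothesis F_derivable : forall q v : 'rV[R]_n, q != 0 -> derivable F q v.
Hypothesis F_root : forall q : 'rV[R]_n, F q ^+ m = contraction m A q [::].
Implicit Types (p q : 'rV[R]_n) (i j k : 'I_n).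

(** A list of indices treats all orders at once: [a_up1], [a_up2] and [a_up3] are the lengths 1, 2
    and 3, and one derivative formula serves them all. *)
Definition acoef (s : seq 'I_n) q : R :=
  contraction m A q s / F q ^+ (m - size s).

Let F_neq0 q : q != 0 -> F q != 0.
Proof. by move=> /F_gt0/lt0r_neq0. Qed.

Lemma acoef_nil q : q != 0 -> acoef [::] q = 1.
Proof.
by move=> q0; rewrite /acoef -F_root subn0 divff // expf_neq0 // F_neq0.
Qed.

Lemma acoef_perm s t q : (size s <= m)%N -> perm_eq s t ->
  acoef s q = acoef t q.
Proof.
move=> sm st.
by rewrite /acoef (perm_size st) (contraction_perm _ symA sm st).
Qed.

Lemma acoef_rcons s q : q != 0 -> (size s < m)%N ->
  \sum_i acoef (rcons s i) q * q 0 i = F q * acoef s q.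
Proof.
move=> /F_neq0 q0 sm; rewrite /acoef contraction_rcons // mulr_suml mulr_sumr.
apply: eq_bigr => i _; rewrite size_rcons -(subnSK sm) exprS.
by field; rewrite q0 expf_neq0.
Qed.

(** The root itself is never differentiated: both sides of F^m = a^{i_1...i_m} p_{i_1} ... p_{i_m}
    are, and m F^(m-1) is cancelled. *)
Lemma is_derive_root p j : (0 < m)%N -> p != 0 ->
  is_derive p (delta_mx 0 j) F (acoef [:: j] p).
Proof.
move=> m0 p0; apply: DeriveDef; first exact: F_derivable.
have dF : is_derive p (delta_mx 0 j) F ('D_(delta_mx 0 j) F p).
  exact/derivableP/F_derivable.
have := derive_val (is_derive := is_deriveX m dF).
rewrite (_ : F ^+ m = contraction m A ^~ [::]); last first.
  by apply/funext => q; rewrite -F_root; rewrite exprfctE.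
have dP := is_derive_contraction p j symA (leq0n m : (size [::] <= m)%N).
rewrite (derive_val (is_derive := dP)).
rewrite subn0 /GRing.scale /= -mulrA => /mulfI DF.
rewrite /acoef /= DF ?pnatr_eq0 -?lt0n // -subn1.
by rewrite mulrAC divff ?mul1r // expf_neq0 // F_neq0.
Qed.

Lemma is_derive_acoef p s j : p != 0 -> (size s < m)%N ->
  is_derive p (delta_mx 0 j) (acoef s)
    ((m - size s)%:R / F p * (acoef (rcons s j) p - acoef s p * acoef [:: j] p)).
Proof.
move=> p0 sm; have Fp := F_neq0 p0.
have dF := is_derive_root j (leq_ltn_trans (leq0n _) sm) p0.
have Fk : (F ^+ (m - size s)) p != 0.
  by rewrite exprfctE expf_neq0.
have dFk := is_deriveX (m - size s) dF.
have dV : is_derive p (delta_mx 0 j) (fun q => ((F ^+ (m - size s)) q)^-1)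
    (- ((F ^+ (m - size s)) p) ^- 2 *:
      (((m - size s)%:R * F p ^+ (m - size s).-1) *: acoef [:: j] p)).
  apply: DeriveDef; first by apply: derivableV => //; case: dFk.
  by rewrite deriveV // derive_val.
have := is_deriveM (is_derive_contraction p j symA (ltnW sm)) dV.
rewrite (_ : _ * _ = acoef s); last first.
  by apply/funext => q; rewrite /acoef exprfctE.
move=> /is_derive_eq; apply.
(* The exponent [m - size s] is exposed as a successor: appending [j] lowers the normalising power
   of [F] by one, whence the factor 1 / F. *)
rewrite /acoef size_rcons -(subnSK sm) /= exprfctE.
rewrite [F p ^+ (_ - _).+1]exprS /GRing.scale /=.
set x := F p ^+ _; have x0 : x != 0 by rewrite expf_neq0.
by field; rewrite Fp x0 expf_neq0.
Qed.

Definition vtorsion i j k q : R :=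
  acoef [:: i; j; k] q - acoef [:: i; j] q * acoef [:: k] q
  - acoef [:: i; k] q * acoef [:: j] q - acoef [:: j; k] q * acoef [:: i] q
  + 2 * acoef [:: i] q * acoef [:: j] q * acoef [:: k] q.

Hypothesis m_ge3 : (3 <= m)%N.

Lemma g_upE p i j : p != 0 -> g_up F p i j =
  (m%:R - 1) * acoef [:: i; j] p
  - (m%:R - 2) * (acoef [:: i] p * acoef [:: j] p).
Proof.
move=> p0.
have [m1 m0] : (1 < m)%N /\ (0 < m)%N by split; apply: leq_trans m_ge3.
rewrite mxE /pdot.
(* The formula for the inner derivative holds only off the origin. The outer derivative depends on
   the germ at [p] alone, and [near_neq0] provides a neighbourhood free of the origin. *)
rewrite (@near_eq_derive _ _ _ _ (fun q => 2 * (F q * acoef [:: j] q))); last first.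
  near=> q; have q0 : q != 0 by near: q; exact: near_neq0.
  have dF := is_derive_root j m0 q0.
  have := derive_val (is_derive := is_deriveX 2 dF).
  by rewrite /GRing.scale /= mulrA.
have dFa := is_deriveM (is_derive_root i m0 p0)
  (is_derive_acoef i p0 (m1 : (size [:: j] < m)%N)).
rewrite (derive_val (is_derive := is_deriveZ 2 dFa)).
rewrite /= (acoef_perm (s := [:: j; i]) (t := [:: i; j])) //; last first.
  exact: permEl (perm_catC [:: j] [:: i]).
rewrite natrB // /GRing.scale /=.
by field; exact: F_neq0.
Unshelve. all: by end_near. Qed.

(** Differentiating a^{ij} brings the factor m - 2 and differentiating a^i brings m - 1; with the
    coefficients in [g_upE], every term acquires (m - 1) (m - 2) / F. *)
Lemma C_upE p i j k : p != 0 -> C_up F p i j k =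
  - ((m%:R - 1) * (m%:R - 2) / (2 * F p)) * vtorsion i j k p.
Proof.
move=> p0.
have [m1 m0] : (1 < m)%N /\ (0 < m)%N by split; apply: leq_trans m_ge3.
rewrite /C_up /pdot.
rewrite (@near_eq_derive _ _ _ _ (fun q => (m%:R - 1) * acoef [:: i; j] q
   - (m%:R - 2) * (acoef [:: i] q * acoef [:: j] q))); last first.
  near=> q; have q0 : q != 0 by near: q; exact: near_neq0.
  by rewrite g_upE.
have dij := is_derive_acoef k p0 (m_ge3 : (size [:: i; j] < m)%N).
have da l := is_derive_acoef k p0 (m1 : (size [:: l] < m)%N).
rewrite (derive_val (is_derive := is_deriveB (is_deriveZ (m%:R - 1) dij)
  (is_deriveZ (m%:R - 2) (is_deriveM (da i) (da j))))).
rewrite /vtorsion /= !natrB // /GRing.scale /=.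
by field; exact: F_neq0.
Unshelve. all: by end_near. Qed.

(** The curvature involves derivatives in the momenta only, so the base point stays fixed and the
    identity is proved within one fibre. *)
Lemma S_up_root p h i j k : p != 0 -> a_up2 m A F p \in unitmx ->
  S_up F p h i j k =
  (m%:R - 1) * (m%:R - 2) ^+ 2 / (4 * F p ^+ 2) *
  alternate (fun j k =>
    \sum_r a_mixed m A F p r i j * a_up3 m A F p r h k
    - a_up2 m A F p i j *
      (a_up2 m A F p h k - a_up1 m A F p h * a_up1 m A F p k)
    + a_up1 m A F p i * a_up1 m A F p j * a_up2 m A F p h k) j k.
Proof.
move=> p0 ua; have Fp := F_neq0 p0.
have [m1 m0] : (1 < m)%N /\ (0 < m)%N by split; apply: leq_trans m_ge3.
have c0 : m%:R - 1 != 0 :> R by rewrite subr_eq0 pnatr_eq1 gtn_eqF.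
pose N := a_up2 m A F p.
pose l r := p 0 r / F p.
pose a1 := a_up1 m A F p.
have NE r s : N r s = acoef [:: r; s] p by rewrite mxE.
have acoef_l s : (size s < m)%N ->
    \sum_r l r * acoef (r :: s) p = acoef s p.
  move=> sm; apply: (mulfI Fp); rewrite -acoef_rcons // mulr_sumr.
  apply: eq_bigr => r _; rewrite (acoef_perm (t := r :: s)) ?size_rcons //.
    by rewrite /l; field.
  exact: permEl (perm_rcons _ _).
have NC r s : N r s = N s r.
  rewrite !NE; apply: acoef_perm => //.
  exact: permEl (perm_catC [:: r] [:: s]).
have symN : N^T = N by apply/matrixP => r s; rewrite mxE.
have N_l r : \sum_s N r s * l s = a1 r.
  rewrite -[RHS](acoef_l [:: r]) //; apply: eq_bigr => s _.
  by rewrite NC NE mulrC.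
have l_a1 : \sum_r l r * a1 r = 1.
  by rewrite -(acoef_nil p0) -acoef_l.
pose x : 'cV[R]_n := \col_r a1 r.
pose y : 'cV[R]_n := \col_r l r.
have Ny : N *m y = x.
  by apply/colP => r; rewrite !mxE -N_l; apply: eq_bigr => s _;
    rewrite [y _ _]mxE.
have yx : y^T *m x = 1%:M.
  apply/matrixP => a b; rewrite !ord1 !mxE eqxx -l_a1.
  by apply: eq_bigr => r _; rewrite !mxE.
(* The factor m - 2 is written as m - 1 - 1 to fit [invmx_rank_one_update] with the scalar m - 1. *)
have gE : g_up F p = (m%:R - 1) *: N - (m%:R - 1 - 1) *: (x *m x^T).
  apply/matrixP => r s; rewrite g_upE // !mxE big_ord1 !mxE.
  by rewrite /a1 /a_up1 /acoef /=; ring.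
have gdE r s : g_down F p r s =
    (m%:R - 1)^-1 * (invmx N r s + (m%:R - 1 - 1) * (l r * l s)).
  rewrite /g_down gE (invmx_rank_one_update c0 ua symN Ny yx).
  by rewrite !mxE big_ord1 !mxE.
have NVx : invmx N *m x = y by rewrite -Ny mulKmx.
have symNV : (invmx N)^T = invmx N by rewrite trmx_inv symN.
have a3C12 r s t : acoef [:: r; s; t] p = acoef [:: s; r; t] p.
  by apply: acoef_perm => //; exact: permEl (perm_catCA [:: r] [:: s] [:: t]).
have a3C23 r s t : acoef [:: r; s; t] p = acoef [:: r; t; s] p.
  apply: acoef_perm => //.
  by rewrite perm_cons; exact: permEl (perm_catC [:: s] [:: t]).
have NV_a1 r : \sum_s invmx N r s * a1 s = l r.
  have := congr1 (fun z : 'cV[R]_n => z r 0) NVx; rewrite !mxE => <-.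
  by apply: eq_bigr => s _; rewrite mxE.
have NV_N r t : \sum_s invmx N r s * acoef [:: s; t] p = (r == t)%:R.
  have := congr1 (fun z : 'M[R]_n => z r t) (mulVmx ua); rewrite !mxE => <-.
  by apply: eq_bigr => s _; rewrite NE.
have NVC r s : invmx N r s = invmx N s r by rewrite -{1}symNV mxE.
have a2C r s : acoef [:: r; s] p = acoef [:: s; r] p by rewrite -!NE NC.
have a2_l r : \sum_s l s * acoef [:: s; r] p = a1 r by exact: acoef_l.
have a3_l r t : \sum_s l s * acoef [:: s; r; t] p = acoef [:: r; t] p.
  exact: acoef_l.
pose G r s := (m%:R - 1)^-1 * (invmx N r s + (m%:R - 1 - 1) * (l r * l s)).
pose V r s t := vtorsion r s t p.
(* This is the factor in [C_upE] up to sign; the sign disappears since each product contains two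
   torsions. *)
pose c := (m%:R - 1) * (m%:R - 2) / (2 * F p).
have CC u v : \sum_r C_mixed F p r i u * C_up F p r h v =
    c ^+ 2 * \sum_r (\sum_s G r s * V s i u) * V r h v.
  rewrite mulr_sumr; apply: eq_bigr => r _; rewrite C_upE // /C_mixed.
  rewrite !mulr_suml mulr_sumr; apply: eq_bigr => s _.
  by rewrite gdE C_upE // -/c -/(G r s) -/(V s i u) -/(V r h v); ring.
pose S u v := \sum_r a_mixed m A F p r i u * a_up3 m A F p r h v.
pose B u v := S u v - acoef [:: i; u] p * (acoef [:: h; v] p - a1 h * a1 v)
  + a1 i * a1 u * acoef [:: h; v] p.
(* Here [N] is the matrix (a^{ij}), so the inverse called [N] in the section [Curvature] is
   [invmx N]. The scalar of that lemma is m - 1, not the local [c]. *)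
have H : \sum_r (\sum_s G r s * V s i j) * V r h k -
    \sum_r (\sum_s G r s * V s i k) * V r h j =
    (m%:R - 1)^-1 * (B j k - B k j) :=
  curvature_rank_one_update a2C a3C12 a3C23 l_a1 a2_l a3_l NVC NV_a1 NV_N
    (m%:R - 1) i j h k.
have altE : alternate (fun j k => S j k - N i j * (N h k - a1 h * a1 k) +
    a1 i * a1 j * N h k) j k = B j k - B k j.
  by rewrite /alternate (NE i j) (NE i k) (NE h j) (NE h k).
transitivity (c ^+ 2 * ((m%:R - 1)^-1 * (B j k - B k j))).
  by rewrite -H mulrBr -(CC j k) -(CC k j) -sumrB.
(* The constant comes from c^2 / (m - 1) = (m - 1) (m - 2)^2 / (4 F^2). *)
rewrite -altE mulrA; congr (_ * _); rewrite /c.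
by field; rewrite Fp c0.
Qed.

End RootMetric.

(** * From one fibre to the Cartan space *)

Unset Implicit Arguments.

Theorem theorem3p1 (R : realType) (n m : nat) (n_ge4 : (4 <= n)%N)
    (m_ge3 : (3 <= m)%N) (M : manifold R n) (K : cotangent M -> R)
    (a : chart R n M -> 'rV[R]_n -> seq 'I_n -> R)
    (K_cartan : cartan_space K) (K_root : mth_root_metric m K a)
    (a_inv : forall (c : chart R n M) (u p : 'rV[R]_n),
      atlas c -> chart_img c u -> p != 0 ->
      a_up2 m (a c u) (local_expr K c u) p \in unitmx) :
  forall (c : chart R n M) (u p : 'rV[R]_n),
    atlas c -> chart_img c u -> p != 0 ->
    let F := local_expr K c u in
    let a1 := a_up1 m (a c u) F p in
    let a2 := a_up2 m (a c u) F p in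
    let a3 := a_up3 m (a c u) F p in
    let am := a_mixed m (a c u) F p in
    forall h i j k : 'I_n,
      S_up F p h i j k =
      (m%:R - 1) * (m%:R - 2) ^+ 2 / (4 * F p ^+ 2) *
      alternate (fun j k => \sum_r am r i j * a3 r h k
                            - a2 i j * (a2 h k - a1 h * a1 k)
                            + a1 i * a1 j * a2 h k) j k.
Proof.
move=> c u p ac cu p0 F a1 a2 a3 am h i j k.
have [symA KE] := K_root c u ac cu.
apply: S_up_root => //; last exact: a_inv.
- by move=> q q0; exact: (cartan_pos K_cartan).
- move=> q v q0.
  (* Smoothness is joint in (x, p); its first level gives differentiability at (u, q), and composing
     with q |-> (u, q) restricts it to the fibre. *)
  have [+ _] := cartan_smooth K_cartan ac 1%N.
  move=> /(_ (u, q) (conj cu q0)) dK.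
  have dq : differentiable (fun q : 'rV[R]_n => (u, q)) q.
    exact: differentiable_pair.
  exact/diff_derivable/(differentiable_comp dq dK).
(* The power [m] undoes the exponent 1 / m because the radicand is nonnegative; this includes
   [q = 0]. *)
- move=> q; rewrite /F (KE q).2 -powR_mulrn ?powR_ge0 // -powRrM mulVf.
    by rewrite powRr1 // (KE q).1.
  by rewrite pnatr_eq0 -lt0n; apply: leq_trans m_ge3.
Qed.
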